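(* Let $C(\cdot,t)$, $t\in(-\infty,+\infty)$, be a family of closed convex smooth embedded curves in $\mathbb{R}^2$ solving the flow $$\frac{\partial C(p,t)}{\partial t}=\Big(\lambda+\int_0^{\xi(p)}\varphi\,d\xi\Big)C+\frac{\varphi}{2}C_\xi,$$ where $\lambda$ is a real constant, and suppose its centro-affine curvature $\varphi$ is uniformly bounded on $S^1\times(-\infty,+\infty)$. Then $\varphi$ converges smoothly to zero as $t\to-\infty$; that is, $C(\cdot,t)$ converges to an ellipse as $t\to-\infty$.
   Context: For $u,v\in\mathbb{R}^2$, $[u,v]$ denotes the determinant of the $2\times 2$ matrix with columns $u,v$. The curves $C(\cdot,t):S^1\to\mathbb{R}^2$, $p\mapsto C(p,t)$, are smooth closed curves with $[C,C_p]\neq 0$ and $[C_p,C_{pp}]\neq 0$ (for such closed curves one has $[C_p,C_{pp}]/[C,C_p]>0$). The centro-affine metric is $g=\sqrt{[C_p,C_{pp}]/[C,C_p]}$, the centro-affine arc-length is $\xi(p)=\int_{p_0}^p g\,dp$ (so $\partial_\xi=g^{-1}\partial_p$), and the centro-affine curvature is $\varphi=[C_{\xi\xi},C]/[C_\xi,C]$. *)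

(* Defs.v *)
From Stdlib Require Import Reals List.
Import ListNotations.
From Coquelicot Require Import Coquelicot.
Open Scope R_scope.

(* A curve family C(p,t) = (x p t, y p t) : R -> R -> R^2, where the
   parameter p in S^1 is represented by p in R with period 1. *)

Definition smooth2 (f : R -> R -> R) : Prop :=
  exists D : list bool -> R -> R -> R,
    (forall p t, D nil p t = f p t) /\
    (forall w p t, is_derive (fun q => D w q t) p (D (cons false w) p t)) /\
    (forall w p t, is_derive (fun s => D w p s) t (D (cons true w) p t)) /\
    (forall w p t, continuous (fun z : R * R => D w (fst z) (snd z)) (p, t)).

Definition dp (f : R -> R -> R) : R -> R -> R :=
  fun p t => Derive (fun q => f q t) p.
Definition dt (f : R -> R -> R) : R -> R -> R :=
  fun p t => Derive (fun s => f p s) t.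

Definition br (u1 u2 v1 v2 : R) : R := u1 * v2 - u2 * v1.

Definition cametric (x y : R -> R -> R) : R -> R -> R :=
  fun p t => sqrt (br (dp x p t) (dp y p t) (dp (dp x) p t) (dp (dp y) p t)
                   / br (x p t) (y p t) (dp x p t) (dp y p t)).

Definition dxi (x y : R -> R -> R) (f : R -> R -> R) : R -> R -> R :=
  fun p t => dp f p t / cametric x y p t.

Fixpoint dxin (x y : R -> R -> R) (k : nat) (f : R -> R -> R) : R -> R -> R :=
  match k with
  | O => f
  | S k' => dxi x y (dxin x y k' f)
  end.

Definition caphi (x y : R -> R -> R) : R -> R -> R :=
  fun p t =>
    br (dxi x y (dxi x y x) p t) (dxi x y (dxi x y y) p t) (x p t) (y p t)
    / br (dxi x y x p t) (dxi x y y p t) (x p t) (y p t).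

(* int_0^{xi(p)} phi dxi, with xi(p) = int_0^p g dp (base point p0 = 0) *)
Definition intphi (x y : R -> R -> R) : R -> R -> R :=
  fun p t => RInt (fun q => caphi x y q t * cametric x y q t) 0 p.

(* Main.v *)
Require Import Defs.
From Stdlib Require Import Reals ZArith Lra Lia FunctionalExtensionality.
From Coquelicot Require Import Coquelicot.
Open Scope R_scope.

(** Write [D] for the arc-length derivative, [phi_k = D^k phi] and [E_k] for
    the integral of [phi_k^2] over the curve.  From [C_xixi = - C + phi C_xi]
    the flow gives [g_t = (phi^2 / 2) g] and
    [phi_t = phi_xixi / 2 + 2 phi - phi^3 / 2].  Hence the length [L] satisfies
    [L' = E_0 / 2 >= 0], so [E_0] is integrable near [t = -oo].  Energy
    estimates [E_k' <= - E_(k+1) / 2 + c E_k + o(1)] turn a vanishing integral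
    of [E_k] over [t-1,t] into [E_k -> 0] and a vanishing integral of [E_(k+1)]
    over [t-1,t]; so all [E_k] tend to [0] by induction.  Every [phi_k] has a
    zero on the closed curve, whence [sup phi_k^2 <= E_k + E_(k+1)]. *)

(** * Smooth functions of two real variables *)

(** The energy inequalities run forward in time while the limit is taken backward, so by themselves
    they give no decay at minus infinity. Smallness has to come from the finite supply of length,
    and is then carried forward over at most one unit of time. The bound on [phi] says nothing about
    its derivatives, so the induction may not use a sup bound at the order being treated. After one
    integration by parts the estimate for E_(n+1) contains only the reaction term of order n. There
    phi_n is multiplied by a coefficient depending on [phi] alone, hence bounded, and everything
    else involves phi_j with j < n, already uniformly small. Monotonicity of the length bounds it in
    the past, so uniformly small terms have small integrals: this is the o(1). *)

Definition cont2 (f : R -> R -> R) : Prop :=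
  forall p t, continuous (fun z : R * R => f (fst z) (snd z)) (p, t).

(** Recursion through [dp] and [dt] themselves makes each closure property an induction on the
    order, instead of the construction of a whole family of derivatives indexed by words as in
    [smooth2]. *)
Fixpoint Cn (n : nat) (f : R -> R -> R) : Prop :=
  cont2 f /\
  match n with
  | O => True
  | S m => (forall p t, ex_derive (fun q => f q t) p) /\
           (forall p t, ex_derive (fun s => f p s) t) /\
           Cn m (dp f) /\ Cn m (dt f)
  end.

Definition Sm (f : R -> R -> R) : Prop := forall n, Cn n f.

Lemma Cn_cont n f : Cn n f -> cont2 f.
Proof. destruct n; intros H; apply H. Qed.

Lemma Cn_pred n f : Cn (S n) f -> Cn n f.
Proof.
revert f; induction n as [|n IH]; intros f H.
- split; [apply (Cn_cont _ _ H) | exact I].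
- destruct H as [H0 [H1 [H2 [H3 H4]]]].
  repeat split; auto.
Qed.

Lemma smooth2_Sm f : smooth2 f -> Sm f.
Proof.
intros [D [D0 [Dp [Dt Dc]]]].
assert (H : forall n w, Cn n (D w)).
{ induction n as [|n IH]; intros w; split; try exact I; try exact (Dc w).
  split; [intros p t; eexists; apply Dp|].
  split; [intros p t; eexists; apply Dt|].
  split.
  - replace (dp (D w)) with (D (cons false w)); [apply IH|].
    extensionality p; extensionality t; symmetry; apply is_derive_unique, Dp.
  - replace (dt (D w)) with (D (cons true w)); [apply IH|].
    extensionality p; extensionality t; symmetry; apply is_derive_unique, Dt. }
intros n; replace f with (D nil); [apply H|].
extensionality p; extensionality t; apply D0.
Qed.

Lemma Sm_dp f : Sm f -> Sm (dp f).
Proof. intros H n; apply (H (S n)). Qed.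

Lemma Sm_dt f : Sm f -> Sm (dt f).
Proof. intros H n; apply (H (S n)). Qed.

Lemma Sm_ex_derive_p f p t : Sm f -> ex_derive (fun q => f q t) p.
Proof. intros H; apply (H 1%nat). Qed.

Lemma Sm_ex_derive_t f p t : Sm f -> ex_derive (fun s => f p s) t.
Proof. intros H; apply (H 1%nat). Qed.

Lemma Sm_is_derive_p f p t : Sm f -> is_derive (fun q => f q t) p (dp f p t).
Proof. intros H; apply Derive_correct, Sm_ex_derive_p, H. Qed.

Lemma Sm_is_derive_t f p t : Sm f -> is_derive (fun s => f p s) t (dt f p t).
Proof. intros H; apply Derive_correct, Sm_ex_derive_t, H. Qed.

Lemma Sm_continuous_p f p t : Sm f -> continuous (fun q => f q t) p.
Proof. intros H; apply (ex_derive_continuous (fun q => f q t)), Sm_ex_derive_p, H. Qed.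

Lemma Sm_continuity_2d f p t : Sm f -> continuity_2d_pt f p t.
Proof. intros H; apply continuity_2d_pt_filterlim; apply (Cn_cont 0 f (H 0%nat)). Qed.

Lemma Cn_const n c : Cn n (fun _ _ => c).
Proof.
revert c; induction n as [|n IH]; intros c; split; try exact I;
  try (intros p t; apply continuous_const).
split; [intros; apply ex_derive_const|].
split; [intros; apply ex_derive_const|].
split.
- replace (dp (fun _ _ => c)) with (fun _ _ : R => 0); [apply IH|].
  extensionality p; extensionality t; symmetry; apply (Derive_const c).
- replace (dt (fun _ _ => c)) with (fun _ _ : R => 0); [apply IH|].
  extensionality p; extensionality t; symmetry; apply (Derive_const c).
Qed.

Lemma Cn_plus n f g : Cn n f -> Cn n g -> Cn n (fun p t => f p t + g p t).
Proof.
revert f g; induction n as [|n IH]; intros f g [fc Hf] [gc Hg]; split; try exact I;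
  try (intros p t; apply (continuous_plus (fun z : R * R => f (fst z) (snd z))
         (fun z : R * R => g (fst z) (snd z)) (p, t) (fc p t) (gc p t))).
destruct Hf as [fp [ft [Hfp Hft]]], Hg as [gp [gt [Hgp Hgt]]].
split; [intros p t; apply (ex_derive_plus (fun q => f q t)); auto|].
split; [intros p t; apply (ex_derive_plus (fun q => f p q)); auto|].
split.
- replace (dp (fun p t => f p t + g p t)) with (fun p t => dp f p t + dp g p t);
    [apply IH; auto|].
  extensionality p; extensionality t; symmetry.
  apply (Derive_plus (fun q => f q t)); auto.
- replace (dt (fun p t => f p t + g p t)) with (fun p t => dt f p t + dt g p t);
    [apply IH; auto|].
  extensionality p; extensionality t; symmetry.
  apply (Derive_plus (fun q => f p q)); auto.
Qed.

Lemma Cn_mult n f g : Cn n f -> Cn n g -> Cn n (fun p t => f p t * g p t).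
Proof.
revert f g; induction n as [|n IH]; intros f g Cf Cg.
all: assert (fc := Cn_cont _ _ Cf); assert (gc := Cn_cont _ _ Cg).
all: split; try exact I;
  try (intros p t; apply (continuous_mult (fun z : R * R => f (fst z) (snd z))
         (fun z : R * R => g (fst z) (snd z)) (p, t) (fc p t) (gc p t))).
assert (Cf' := Cn_pred _ _ Cf); assert (Cg' := Cn_pred _ _ Cg).
destruct Cf as [_ [fp [ft [Hfp Hft]]]], Cg as [_ [gp [gt [Hgp Hgt]]]].
split; [intros p t; apply (ex_derive_mult (fun q => f q t)); auto|].
split; [intros p t; apply (ex_derive_mult (fun q => f p q)); auto|].
split.
- replace (dp (fun p t => f p t * g p t))
    with (fun p t => dp f p t * g p t + f p t * dp g p t);
    [apply (Cn_plus n (fun p t => dp f p t * g p t)); auto|].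
  extensionality p; extensionality t; symmetry.
  apply (Derive_mult (fun q => f q t)); auto.
- replace (dt (fun p t => f p t * g p t))
    with (fun p t => dt f p t * g p t + f p t * dt g p t);
    [apply (Cn_plus n (fun p t => dt f p t * g p t)); auto|].
  extensionality p; extensionality t; symmetry.
  apply (Derive_mult (fun q => f p q)); auto.
Qed.

Lemma Sm_const c : Sm (fun _ _ => c).
Proof. intros n; apply Cn_const. Qed.

Lemma Sm_plus f g : Sm f -> Sm g -> Sm (fun p t => f p t + g p t).
Proof. intros Hf Hg n; apply Cn_plus; auto. Qed.

Lemma Sm_mult f g : Sm f -> Sm g -> Sm (fun p t => f p t * g p t).
Proof. intros Hf Hg n; apply Cn_mult; auto. Qed.

Lemma Sm_opp f : Sm f -> Sm (fun p t => - f p t).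
Proof.
intros Hf; replace (fun p t => - f p t) with (fun p t => (-1) * f p t).
- apply (Sm_mult (fun _ _ => -1)); auto using Sm_const.
- extensionality p; extensionality t; ring.
Qed.

Lemma Sm_minus f g : Sm f -> Sm g -> Sm (fun p t => f p t - g p t).
Proof. intros Hf Hg; apply Sm_plus; auto; apply Sm_opp; auto. Qed.

Lemma Sm_pow f k : Sm f -> Sm (fun p t => f p t ^ k).
Proof.
intros Hf; induction k as [|k IH]; simpl; [apply Sm_const | apply Sm_mult; auto].
Qed.

(* Chain rule: smoothness of [h o f] follows from that of its formal
   first derivatives [dp f * k] and [dt f * k], where [k = h' o f]. *)
Lemma Cn_comp (h k : R -> R) n f :
  Sm f -> (forall p t, is_derive h (f p t) (k (f p t))) ->
  Cn n (fun p t => k (f p t)) -> Cn (S n) (fun p t => h (f p t)).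
Proof.
intros Hf Hh Hk.
split.
{ intros p t; apply (continuous_comp (fun z : R * R => f (fst z) (snd z)) h).
  - apply (Cn_cont 0 f (Hf 0%nat)).
  - apply (ex_derive_continuous h); eexists; apply Hh. }
assert (Dp : forall p t, is_derive (fun q => h (f q t)) p (dp f p t * k (f p t))).
{ intros p t; apply (is_derive_comp h (fun q => f q t)); [apply Hh | apply Sm_is_derive_p, Hf]. }
assert (Dt : forall p t, is_derive (fun q => h (f p q)) t (dt f p t * k (f p t))).
{ intros p t; apply (is_derive_comp h (fun q => f p q)); [apply Hh | apply Sm_is_derive_t, Hf]. }
split; [intros p t; eexists; apply Dp|].
split; [intros p t; eexists; apply Dt|].
split.
- replace (dp (fun p t => h (f p t))) with (fun p t => dp f p t * k (f p t));
    [apply Cn_mult; auto; apply Sm_dp, Hf|].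
  extensionality p; extensionality t; symmetry; apply is_derive_unique, Dp.
- replace (dt (fun p t => h (f p t))) with (fun p t => dt f p t * k (f p t));
    [apply Cn_mult; auto; apply Sm_dt, Hf|].
  extensionality p; extensionality t; symmetry; apply is_derive_unique, Dt.
Qed.

(** The derivative of the inverse is a polynomial in the inverse, so each order of smoothness yields
    the next through [Cn_comp]. *)
Lemma Sm_inv f : Sm f -> (forall p t, f p t <> 0) -> Sm (fun p t => / f p t).
Proof.
intros Hf Hn n; apply Cn_pred.
induction n as [|n IH];
  apply (Cn_comp Rinv (fun u => - (/ u * / u))); auto.
1, 3: intros p t; auto_derive; [apply Hn | field; apply Hn].
- split; [|exact I]; intros p t.
  apply (continuous_comp (fun z : R * R => f (fst z) (snd z)) (fun u => - (/ u * / u))).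
  + apply (Cn_cont 0 f (Hf 0%nat)).
  + apply (ex_derive_continuous (fun u => - (/ u * / u))); auto_derive; auto.
- replace (fun p t => - (/ f p t * / f p t))
    with (fun p t => (-1) * (/ f p t * / f p t));
    [|extensionality p; extensionality t; ring].
  apply (Cn_mult (S n) (fun _ _ => -1)); [apply Cn_const | apply Cn_mult; auto].
Qed.

Lemma Sm_div f g : Sm f -> Sm g -> (forall p t, g p t <> 0) ->
  Sm (fun p t => f p t / g p t).
Proof. intros Hf Hg Hn; apply Sm_mult; auto; apply Sm_inv; auto. Qed.

Lemma Sm_sqrt f : Sm f -> (forall p t, 0 < f p t) -> Sm (fun p t => sqrt (f p t)).
Proof.
intros Hf Hn n; apply Cn_pred.
assert (Hs : forall p t, sqrt (f p t) <> 0).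
{ intros p t; apply Rgt_not_eq, sqrt_lt_R0, Hn. }
(* Rewriting the derivative of the root as the root times a smooth function closes the same
   bootstrap as for the inverse. *)
assert (E : (fun p t => / (2 * sqrt (f p t))) = (fun p t => sqrt (f p t) * (/ 2 * / f p t))).
{ extensionality p; extensionality t.
  assert (H := sqrt_sqrt (f p t) (Rlt_le _ _ (Hn p t))).
  rewrite <- H at 3; field; apply Hs. }
assert (Hd : forall p t, is_derive sqrt (f p t) (/ (2 * sqrt (f p t)))).
{ intros p t; auto_derive; [apply Hn | field; apply Hs]. }
assert (C0 : Cn 0 (fun p t => sqrt (f p t))).
{ split; [|exact I]; intros p t.
  apply (continuous_comp (fun z : R * R => f (fst z) (snd z)) sqrt).
  - apply (Cn_cont 0 f (Hf 0%nat)).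
  - apply (ex_derive_continuous sqrt); eexists; apply Hd. }
assert (Ck : forall m, Cn m (fun p t => sqrt (f p t)) ->
             Cn m (fun p t => / (2 * sqrt (f p t)))).
{ intros m Hm; rewrite E; apply Cn_mult; auto.
  apply (Cn_mult m (fun _ _ => / 2)); [apply Cn_const|].
  apply Sm_inv; auto; intros p t; apply Rgt_not_eq, Hn. }
induction n as [|n IH];
  apply (Cn_comp sqrt (fun u => / (2 * sqrt u))); auto.
Qed.

Lemma dp_dt f : Sm f -> dp (dt f) = dt (dp f).
Proof.
intros Hf; extensionality p; extensionality t.
apply (Schwarz f p t).
- exists (mkposreal 1 Rlt_0_1); intros u v _ _.
  repeat split; [apply Sm_ex_derive_p | apply Sm_ex_derive_t | apply (Sm_ex_derive_p (dt f)) | apply (Sm_ex_derive_t (dp f))];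
    auto using Sm_dp, Sm_dt.
- apply (Sm_continuity_2d (dp (dt f))); auto using Sm_dp, Sm_dt.
- apply (Sm_continuity_2d (dt (dp f))); auto using Sm_dp, Sm_dt.
Qed.

Lemma dp_plus f g p t : Sm f -> Sm g ->
  dp (fun p t => f p t + g p t) p t = dp f p t + dp g p t.
Proof. intros Hf Hg; apply (Derive_plus (fun q => f q t)); apply Sm_ex_derive_p; auto. Qed.

Lemma dp_scal c f p t : dp (fun p t => c * f p t) p t = c * dp f p t.
Proof. apply (Derive_scal (fun q => f q t)). Qed.

Lemma dp_mult f g p t : Sm f -> Sm g ->
  dp (fun p t => f p t * g p t) p t = dp f p t * g p t + f p t * dp g p t.
Proof. intros Hf Hg; apply (Derive_mult (fun q => f q t)); apply Sm_ex_derive_p; auto. Qed.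

Lemma dp_minus f g p t : Sm f -> Sm g ->
  dp (fun p t => f p t - g p t) p t = dp f p t - dp g p t.
Proof. intros Hf Hg; apply (Derive_minus (fun q => f q t)); apply Sm_ex_derive_p; auto. Qed.

Lemma dp_div f g p t : Sm f -> Sm g -> (forall p t, g p t <> 0) ->
  dp (fun p t => f p t / g p t) p t =
  (dp f p t * g p t - f p t * dp g p t) / g p t ^ 2.
Proof.
intros Hf Hg Hn; apply (Derive_div (fun q => f q t) (fun q => g q t)); auto; apply Sm_ex_derive_p; auto.
Qed.

Lemma dp_const c p t : dp (fun _ _ => c) p t = 0.
Proof. apply (Derive_const c). Qed.

Lemma dt_const c p t : dt (fun _ _ => c) p t = 0.
Proof. apply (Derive_const c). Qed.

Lemma dt_plus f g p t : Sm f -> Sm g ->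
  dt (fun p t => f p t + g p t) p t = dt f p t + dt g p t.
Proof. intros Hf Hg; apply (Derive_plus (fun q => f p q)); apply Sm_ex_derive_t; auto. Qed.

Lemma dt_scal c f p t : dt (fun p t => c * f p t) p t = c * dt f p t.
Proof. apply (Derive_scal (fun q => f p q)). Qed.

Lemma dt_mult f g p t : Sm f -> Sm g ->
  dt (fun p t => f p t * g p t) p t = dt f p t * g p t + f p t * dt g p t.
Proof. intros Hf Hg; apply (Derive_mult (fun q => f p q)); apply Sm_ex_derive_t; auto. Qed.

Lemma dt_div f g p t : Sm f -> Sm g -> (forall p t, g p t <> 0) ->
  dt (fun p t => f p t / g p t) p t =
  (dt f p t * g p t - f p t * dt g p t) / g p t ^ 2.
Proof.
intros Hf Hg Hn; apply (Derive_div (fun q => f p q) (fun q => g p q)); auto; apply Sm_ex_derive_t; auto.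
Qed.

Ltac sm := repeat first
  [ assumption | apply Sm_const | apply Sm_plus | apply Sm_minus | apply Sm_opp
  | apply Sm_pow | apply Sm_mult | apply Sm_inv | apply Sm_dp | apply Sm_dt ].

(** * Periodicity *)

Definition per (f : R -> R -> R) : Prop := forall p t, f (p + 1) t = f p t.

Lemma per_dp f : Sm f -> per f -> per (dp f).
Proof.
intros Hf Pf p t.
assert (H : is_derive (fun q => f (q + 1) t) p (dp f (p + 1) t)).
{ replace (dp f (p + 1) t) with (1 * dp f (p + 1) t) by ring.
  apply (is_derive_comp (fun q => f q t) (fun q => q + 1)).
  - apply Sm_is_derive_p, Hf.
  - auto_derive; auto. }
apply is_derive_unique in H; rewrite <- H.
apply Derive_ext; intros q; apply Pf.
Qed.

Lemma per_reduce (f : R -> R -> R) : per f ->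
  forall p, exists q, 0 <= q <= 1 /\ forall t, f p t = f q t.
Proof.
intros Pf.
assert (Hn : forall n p t, f (p + INR n) t = f p t).
{ induction n as [|n IH]; intros p t.
  - simpl; f_equal; ring.
  - rewrite S_INR, <- Rplus_assoc, Pf; apply IH. }
assert (Hz : forall z p t, f (p + IZR z) t = f p t).
{ intros z p t; destruct (Z.le_gt_cases 0 z).
  - rewrite <- (Z2Nat.id z) by lia; rewrite <- INR_IZR_INZ; apply Hn.
  - rewrite <- (Hn (Z.to_nat (- z)) (p + IZR z) t).
    rewrite INR_IZR_INZ, Z2Nat.id, opp_IZR by lia; f_equal; ring. }
intros p; exists (p + IZR (- Int_part p)); split.
- rewrite opp_IZR; destruct (base_Int_part p); lra.
- intros t; symmetry; apply Hz.
Qed.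

Lemma per_dp_zero f t : Sm f -> per f -> exists q, 0 <= q <= 1 /\ dp f q t = 0.
Proof.
intros Hf Pf.
destruct (MVT_gen (fun q => f q t) 0 1 (fun q => dp f q t)) as [c [Hc H]].
- intros q _; apply Sm_is_derive_p, Hf.
- intros q _; apply continuity_pt_filterlim, Sm_continuous_p, Hf.
- rewrite Rmin_left, Rmax_right in Hc by lra.
  exists c; split; [exact Hc|].
  specialize (Pf 0 t); rewrite Rplus_0_l in Pf; simpl in H; lra.
Qed.

(** * Decay of energies as time tends to minus infinity *)

Lemma derive_nonneg_le (f f' : R -> R) a b :
  a <= b -> (forall s, a <= s <= b -> is_derive f s (f' s)) ->
  (forall s, a <= s <= b -> 0 <= f' s) -> f a <= f b.
Proof.
intros Hab Hd Hp.
destruct (MVT_gen f a b f') as [c [Hc H]].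
- rewrite Rmin_left, Rmax_right by lra; intros s Hs; apply Hd; lra.
- rewrite Rmin_left, Rmax_right by lra; intros s Hs.
  apply continuity_pt_filterlim, (ex_derive_continuous f); eexists; apply Hd, Hs.
- rewrite Rmin_left, Rmax_right in Hc by lra.
  specialize (Hp c Hc); nra.
Qed.

Definition vanishes (h : R -> R) : Prop :=
  forall eps, 0 < eps -> exists T, forall t, t <= T -> Rabs (h t) < eps.

(* [A] is a primitive of [E], so [A t - A (t - 1)] is the integral of [E] over [t-1,t]. *)
Definition window_vanishes (E : R -> R) : Prop :=
  exists A : R -> R, (forall t, is_derive A t (E t)) /\ vanishes (fun t => A t - A (t - 1)).

Lemma vanishes_plus h1 h2 : vanishes h1 -> vanishes h2 -> vanishes (fun t => h1 t + h2 t).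
Proof.
intros H1 H2 eps He.
destruct (H1 (eps / 2)) as [T1 K1]; [lra|].
destruct (H2 (eps / 2)) as [T2 K2]; [lra|].
exists (Rmin T1 T2); intros t Ht.
assert (Ht1 : t <= T1) by (eapply Rle_trans; [apply Ht | apply Rmin_l]).
assert (t <= T2) by (eapply Rle_trans; [apply Ht | apply Rmin_r]).
specialize (K1 t ltac:(lra)); specialize (K2 t ltac:(lra)).
assert (Htri := Rabs_triang (h1 t) (h2 t)); lra.
Qed.

Lemma vanishes_scal c h : vanishes h -> vanishes (fun t => c * h t).
Proof.
intros H eps He.
assert (Hc := Rabs_pos c).
destruct (H (eps / (Rabs c + 1))) as [T K]; [apply Rdiv_lt_0_compat; lra|].
exists T; intros t Ht; specialize (K t Ht).
rewrite Rabs_mult.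
apply (Rmult_lt_compat_r (Rabs c + 1)) in K; [|lra].
unfold Rdiv in K; rewrite Rmult_assoc, Rinv_l, Rmult_1_r in K by lra.
assert (Hh := Rabs_pos (h t)); nra.
Qed.

Lemma vanishes_le h1 h2 : vanishes h2 ->
  (exists T, forall t, t <= T -> 0 <= h1 t <= h2 t) -> vanishes h1.
Proof.
intros H [T0 Hle] eps He; destruct (H eps He) as [T K].
exists (Rmin T0 T); intros t Ht.
assert (t <= T0) by (eapply Rle_trans; [apply Ht | apply Rmin_l]).
assert (t <= T) by (eapply Rle_trans; [apply Ht | apply Rmin_r]).
specialize (Hle t ltac:(lra)); specialize (K t ltac:(lra)).
rewrite Rabs_pos_eq in K |- * by lra; lra.
Qed.

Lemma bounded_primitive_window (L E : R -> R) c :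
  (forall t, is_derive L t (E t)) -> (forall t, 0 <= E t) -> (forall t, c <= L t) ->
  window_vanishes E.
Proof.
intros HL HE Hc; exists L; split; [exact HL|].
assert (Hmon : forall s t, s <= t -> L s <= L t).
{ intros s t Hst; apply (derive_nonneg_le L E); auto. }
(* [- l] is the infimum of the nondecreasing [L], hence its limit at minus infinity; increments over
   unit windows are therefore small there. *)
destruct (completeness (fun v => exists t, v = - L t)) as [l [Hub Hlub]].
- exists (- c); intros v [t ->]; specialize (Hc t); lra.
- exists (- L 0), 0; reflexivity.
- intros eps He.
  destruct (Classical_Prop.classic (exists T, L T < - l + eps)) as [[T HT]|Hno].
  + exists T; intros t Ht.
    assert (H1 := Hmon t T Ht); assert (H2 := Hmon (t - 1) t ltac:(lra)).
    assert (H3 : - L (t - 1) <= l) by (apply Hub; exists (t - 1); reflexivity).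
    rewrite Rabs_pos_eq by lra; lra.
  + exfalso; assert (l <= l - eps); [|lra].
    apply Hlub; intros v [t ->].
    apply Rnot_lt_le; intros H; apply Hno; exists t; lra.
Qed.

Lemma primitive_exists (F : R -> R) : (forall t, continuous F t) ->
  exists A : R -> R, forall t, is_derive A t (F t).
Proof.
intros HF; exists (fun t => RInt F 0 t); intros t.
apply (is_derive_RInt F _ 0 t); [|apply HF].
exists (mkposreal 1 Rlt_0_1); intros b _.
apply (RInt_correct F), ex_RInt_continuous; intros z _; apply HF.
Qed.

(* By the mean value theorem [E] equals its window integral somewhere in
   [t-1,t]; integrating the inequality from there bounds [E t], and
   integrating it over the whole window then bounds the window integral of [F]. *)
Lemma energy_step (E F : R -> R) c :
  0 <= c -> (forall t, 0 <= E t) -> (forall t, 0 <= F t) ->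
  (forall t, ex_derive E t) -> (forall t, continuous F t) ->
  (forall eps, 0 < eps -> exists T, forall t, t <= T ->
     Derive E t <= - (/ 2 * F t) + c * E t + eps) ->
  window_vanishes E -> vanishes E /\ window_vanishes F.
Proof.
intros Hc HE HF DE CF Hin [A [DA VA]].
destruct (primitive_exists F CF) as [B DB].
assert (MA : forall s t, s <= t -> A s <= A t).
{ intros s t Hst; apply (derive_nonneg_le A E); auto. }
assert (MB : forall s t, s <= t -> B s <= B t).
{ intros s t Hst; apply (derive_nonneg_le B F); auto. }
assert (Key : forall eps, 0 < eps -> exists T, forall s t, s <= t -> t <= T ->
   E t + / 2 * (B t - B s) <= E s + c * (A t - A s) + eps * (t - s)).
{ intros eps He; destruct (Hin eps He) as [T HT].
  exists T; intros s t Hst HtT.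
  assert (H : c * A s + eps * s - / 2 * B s - E s <= c * A t + eps * t - / 2 * B t - E t).
  { apply (derive_nonneg_le (fun u => c * A u + eps * u - / 2 * B u - E u)
             (fun u => c * E u + eps - / 2 * F u - Derive E u)); [exact Hst| |].
    - intros u _; auto_derive.
      + repeat split; [eexists; apply DA | eexists; apply DB | apply DE].
      + assert (EA : Derive (fun x : R => A x) u = E u) by apply is_derive_unique, DA.
        assert (EB : Derive (fun x : R => B x) u = F u) by apply is_derive_unique, DB.
        rewrite EA, EB; change (Derive (fun x : R => E x) u) with (Derive E u); ring.
    - intros u Hu; specialize (HT u ltac:(lra)); lra. }
  lra. }
assert (VE : vanishes E).
{ intros eps He.
  destruct (Key (eps / 2)) as [T1 K1]; [lra|].
  (* The window integral is used once as the value [E s] at the mean value point and [c] times as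
     the growth from [s] to [t]. *)
  destruct (vanishes_scal (1 + c) _ VA (eps / 2)) as [T2 K2]; [lra|].
  exists (Rmin T1 T2); intros t Ht.
  assert (Ht1 : t <= T1) by (eapply Rle_trans; [apply Ht | apply Rmin_l]).
  assert (t <= T2) by (eapply Rle_trans; [apply Ht | apply Rmin_r]).
  specialize (K2 t ltac:(lra)); apply Rabs_def2 in K2.
  destruct (MVT_gen A (t - 1) t E) as [s [Hs Es]].
  - intros u _; apply DA.
  - intros u _; apply continuity_pt_filterlim, (ex_derive_continuous A); eexists; apply DA.
  - rewrite Rmin_left, Rmax_right in Hs by lra.
    specialize (K1 s t ltac:(lra) ltac:(lra)).
    assert (H1 := MB s t ltac:(lra)); assert (H2 := MA (t - 1) s ltac:(lra)).
    rewrite Rabs_pos_eq by apply HE; nra. }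
split; [exact VE|].
exists B; split; [exact DB|].
intros eps He.
(* Three terms below [eps / 8] bound half the increment of [B], so the increment itself stays below
   [3 * eps / 4]. *)
destruct (Key (eps / 8)) as [T1 K1]; [lra|].
destruct (vanishes_scal c _ VA (eps / 8)) as [T2 K2]; [lra|].
destruct (VE (eps / 8)) as [T3 K3]; [lra|].
exists (Rmin T1 (Rmin T2 T3)); intros t Ht.
assert (Ht1 : t <= T1) by (eapply Rle_trans; [apply Ht | apply Rmin_l]).
assert (t <= T2).
{ eapply Rle_trans; [apply Ht|]; eapply Rle_trans; [apply Rmin_r | apply Rmin_l]. }
assert (t <= T3).
{ eapply Rle_trans; [apply Ht|]; eapply Rle_trans; [apply Rmin_r | apply Rmin_r]. }
specialize (K1 (t - 1) t ltac:(lra) ltac:(lra)).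
specialize (K2 t ltac:(lra)); apply Rabs_def2 in K2.
specialize (K3 (t - 1) ltac:(lra)); apply Rabs_def2 in K3.
assert (H1 := MB (t - 1) t ltac:(lra)); assert (H2 := HE t).
rewrite Rabs_pos_eq by lra; lra.
Qed.

(** * The curvature equation on an evolving circle *)

Definition arc (g f : R -> R -> R) : R -> R -> R := fun p t => dp f p t / g p t.

Fixpoint arcn (g : R -> R -> R) (k : nat) (f : R -> R -> R) : R -> R -> R :=
  match k with O => f | S m => arc g (arcn g m f) end.

(* No constant term: such polynomials in the [phi_j] tend to [0] with them. *)
Inductive dpoly : Type :=
| DZero : dpoly
| DVar : nat -> dpoly
| DAdd : dpoly -> dpoly -> dpoly
| DMul : dpoly -> dpoly -> dpoly
| DScale : R -> dpoly -> dpoly.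

Fixpoint dder (P : dpoly) : dpoly :=
  match P with
  | DZero => DZero
  | DVar j => DVar (S j)
  | DAdd P Q => DAdd (dder P) (dder Q)
  | DMul P Q => DAdd (DMul (dder P) Q) (DMul P (dder Q))
  | DScale c P => DScale c (dder P)
  end.

Fixpoint dord (m : nat) (P : dpoly) : Prop :=
  match P with
  | DZero => True
  | DVar j => (j <= m)%nat
  | DAdd P Q | DMul P Q => dord m P /\ dord m Q
  | DScale _ P => dord m P
  end.

Fixpoint deval (v : nat -> R -> R -> R) (P : dpoly) : R -> R -> R :=
  match P with
  | DZero => fun _ _ => 0
  | DVar j => v j
  | DAdd P Q => fun p t => deval v P p t + deval v Q p t
  | DMul P Q => fun p t => deval v P p t * deval v Q p t
  | DScale c P => fun p t => c * deval v P p t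
  end.

Lemma dord_S m P : dord m P -> dord (S m) P.
Proof. induction P; simpl; intuition. Qed.

Lemma dord_dder m P : dord m P -> dord (S m) (dder P).
Proof. induction P; simpl; intuition auto using dord_S with arith. Qed.

Definition uvanishes (f : R -> R -> R) : Prop :=
  forall eps, 0 < eps -> exists T, forall t p, t <= T -> Rabs (f p t) < eps.

Lemma uvanishes_deval v m P :
  (forall j, (j <= m)%nat -> uvanishes (v j)) -> dord m P -> uvanishes (deval v P).
Proof.
intros Hv; induction P as [|j|P IHP Q IHQ|P IHP Q IHQ|c P IHP]; simpl; intros Ho.
- intros eps He; exists 0; intros t p _; rewrite Rabs_R0; exact He.
- apply Hv, Ho.
- intros eps He; destruct Ho as [HP HQ].
  destruct (IHP HP (eps / 2)) as [T1 K1]; [lra|].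
  destruct (IHQ HQ (eps / 2)) as [T2 K2]; [lra|].
  exists (Rmin T1 T2); intros t p Ht.
  specialize (K1 t p (Rle_trans _ _ _ Ht (Rmin_l _ _))).
  specialize (K2 t p (Rle_trans _ _ _ Ht (Rmin_r _ _))).
  assert (Htri := Rabs_triang (deval v P p t) (deval v Q p t)); lra.
- intros eps He; destruct Ho as [HP HQ].
  destruct (IHP HP eps He) as [T1 K1].
  (* For a product, one small factor suffices once the other is below 1. *)
  destruct (IHQ HQ 1 Rlt_0_1) as [T2 K2].
  exists (Rmin T1 T2); intros t p Ht.
  specialize (K1 t p (Rle_trans _ _ _ Ht (Rmin_l _ _))).
  specialize (K2 t p (Rle_trans _ _ _ Ht (Rmin_r _ _))).
  rewrite Rabs_mult.
  assert (H1 := Rabs_pos (deval v P p t)); assert (H2 := Rabs_pos (deval v Q p t)); nra.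
- intros eps He; assert (Hc := Rabs_pos c).
  destruct (IHP Ho (eps / (Rabs c + 1))) as [T K]; [apply Rdiv_lt_0_compat; lra|].
  exists T; intros t p Ht; specialize (K t p Ht).
  rewrite Rabs_mult.
  apply (Rmult_lt_compat_r (Rabs c + 1)) in K; [|lra].
  unfold Rdiv in K; rewrite Rmult_assoc, Rinv_l, Rmult_1_r in K by lra.
  assert (Hh := Rabs_pos (deval v P p t)); nra.
Qed.

Lemma RInt_ext_real (f h : R -> R) a b : (forall p, f p = h p) -> RInt f a b = RInt h a b.
Proof. intros H; apply RInt_ext; intros p _; apply H. Qed.

Section ArcLength.

Variable g : R -> R -> R.
Hypothesis g_smooth : Sm g.
Hypothesis g_neq : forall p t, g p t <> 0.

Lemma Sm_arc f : Sm f -> Sm (arc g f).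
Proof. intros Hf; apply Sm_div; auto; apply Sm_dp, Hf. Qed.

Lemma per_arc f : per g -> Sm f -> per f -> per (arc g f).
Proof. intros Pg Hf Pf p t; unfold arc; rewrite (per_dp f Hf Pf), Pg; reflexivity. Qed.

Lemma arc_plus f h p t : Sm f -> Sm h ->
  arc g (fun p t => f p t + h p t) p t = arc g f p t + arc g h p t.
Proof.
intros Hf Hh; unfold arc; rewrite dp_plus by assumption.
field; apply g_neq.
Qed.

Lemma arc_scal c f p t : arc g (fun p t => c * f p t) p t = c * arc g f p t.
Proof.
unfold arc; rewrite dp_scal; field; apply g_neq.
Qed.

Lemma arc_mult f h p t : Sm f -> Sm h ->
  arc g (fun p t => f p t * h p t) p t = arc g f p t * h p t + f p t * arc g h p t.
Proof.
intros Hf Hh; unfold arc; rewrite dp_mult by assumption.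
field; apply g_neq.
Qed.

Lemma arc_const c p t : arc g (fun _ _ => c) p t = 0.
Proof. unfold arc; rewrite dp_const; field; apply g_neq. Qed.

(** [dp] and [dt] commute, so the commutator of [dt] with the arc-length derivative comes only from
    the time dependence of [g]. *)
Lemma dt_arc f p t : Sm f ->
  dt (arc g f) p t = arc g (dt f) p t - dt g p t / g p t * arc g f p t.
Proof.
intros Hf; unfold arc; rewrite (dp_dt f Hf), dt_div by (auto using Sm_dp).
field; apply g_neq.
Qed.

(** * Evolution of metric and curvature from the structure equation of the curve *)

Section EvolutionEquations.

Variables (x y phi U : R -> R -> R).
Hypothesis x_smooth : Sm x.
Hypothesis y_smooth : Sm y.
Hypothesis phi_smooth : Sm phi.
Hypothesis U_smooth : Sm U.
Hypothesis arc2_x : forall p t, arc g (arc g x) p t = - x p t + phi p t * arc g x p t.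
Hypothesis arc2_y : forall p t, arc g (arc g y) p t = - y p t + phi p t * arc g y p t.
Hypothesis frame : forall p t, x p t * arc g y p t - y p t * arc g x p t <> 0.
Hypothesis arc_U : forall p t, arc g U p t = phi p t.
Hypothesis flow_x : forall p t, dt x p t = U p t * x p t + phi p t / 2 * arc g x p t.
Hypothesis flow_y : forall p t, dt y p t = U p t * y p t + phi p t / 2 * arc g y p t.

(** For a coordinate z of the curve, the time derivative of z_xi is [phi / 2] times z plus [B] times
    z_xi; the first coefficient is U_xi - phi / 2, simplified by U_xi = phi. *)
Let beta p t := dt g p t / g p t.
Let B p t := U p t + / 2 * arc g phi p t + / 2 * (phi p t * phi p t) - beta p t.

Let beta_smooth : Sm beta.
Proof. unfold beta; sm. Qed.

Let B_smooth : Sm B.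
Proof. assert (H := Sm_arc phi phi_smooth); unfold B; sm. Qed.

(* Both sides of [dt z_xixi = dt (- z + phi z_xi)] expanded in the frame [(z, z_xi)]. *)
Lemma frame_compatibility z p t : Sm z ->
  (forall p t, arc g (arc g z) p t = - z p t + phi p t * arc g z p t) ->
  (forall p t, dt z p t = U p t * z p t + phi p t / 2 * arc g z p t) ->
  (2 * beta p t - phi p t ^ 2) * z p t +
  (phi p t + arc g B p t - beta p t * phi p t - dt phi p t) * arc g z p t = 0.
Proof.
intros Sz z2 zt.
assert (Sz1 := Sm_arc z Sz).
assert (zt1 : dt (arc g z) = fun p t => / 2 * (phi p t * z p t) + B p t * arc g z p t).
{ extensionality a; extensionality b.
  rewrite dt_arc by assumption.
  replace (dt z) with (fun p t => U p t * z p t + / 2 * (phi p t * arc g z p t))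
    by (extensionality a'; extensionality b'; rewrite zt; field).
  rewrite arc_plus, arc_scal, !arc_mult, arc_U, z2 by sm.
  unfold B, beta; field; apply g_neq. }
assert (E : dt (arc g (arc g z)) p t =
  dt (fun p t => (-1) * z p t + phi p t * arc g z p t) p t).
{ f_equal; extensionality a; extensionality b; rewrite z2; ring. }
rewrite dt_arc, zt1 in E by assumption.
rewrite dt_plus, dt_scal, dt_mult, zt, zt1 in E by sm.
rewrite arc_plus, arc_scal, !arc_mult, !z2 in E by sm.
fold (beta p t) in E.
set (aB := arc g B p t) in *; unfold B in E.
apply Rminus_diag_eq in E; rewrite <- E; field.
Qed.

Lemma frame_independent a b p t :
  a * x p t + b * arc g x p t = 0 -> a * y p t + b * arc g y p t = 0 -> a = 0 /\ b = 0.
Proof.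
intros Hx Hy; assert (Hf := frame p t).
set (w := x p t * arc g y p t - y p t * arc g x p t) in *.
assert (Ha : a * w = 0).
{ transitivity ((a * x p t + b * arc g x p t) * arc g y p t
                - (a * y p t + b * arc g y p t) * arc g x p t).
  - unfold w; ring.
  - rewrite Hx, Hy; ring. }
assert (Hb : b * w = 0).
{ transitivity ((a * y p t + b * arc g y p t) * x p t
                - (a * x p t + b * arc g x p t) * y p t).
  - unfold w; ring.
  - rewrite Hx, Hy; ring. }
destruct (Rmult_integral _ _ Ha), (Rmult_integral _ _ Hb); tauto.
Qed.

(** The compatibility relation has the same coefficients for both coordinates, and (C, C_xi) is a
    basis, so both coefficients vanish. The first gives the law of the metric, the second that of
    the curvature. *)
Lemma evolution_coefficients p t :
  2 * beta p t - phi p t ^ 2 = 0 /\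
  phi p t + arc g B p t - beta p t * phi p t - dt phi p t = 0.
Proof. apply (frame_independent _ _ p t); apply frame_compatibility; assumption. Qed.

Lemma metric_evolution p t : dt g p t = phi p t ^ 2 / 2 * g p t.
Proof.
destruct (evolution_coefficients p t) as [H _].
replace (phi p t ^ 2 / 2) with (beta p t) by lra.
unfold beta; field; apply g_neq.
Qed.

Lemma curvature_evolution p t :
  dt phi p t = / 2 * arc g (arc g phi) p t + 2 * phi p t - / 2 * phi p t ^ 3.
Proof.
destruct (evolution_coefficients p t) as [Hb H].
(* Once [beta] equals phi^2 / 2, the non-local speed enters only through B_xi, where U_xi = phi
   makes it local. *)
assert (EB : B = fun p t => U p t + / 2 * arc g phi p t).
{ extensionality a; extensionality b; unfold B.
  destruct (evolution_coefficients a b) as [Hab _]; lra. }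
assert (S1 := Sm_arc phi phi_smooth).
rewrite EB, arc_plus, arc_scal, arc_U in H by sm.
replace (beta p t) with (/ 2 * phi p t ^ 2) in H by lra; lra.
Qed.

End EvolutionEquations.

(** * The scalar reaction-diffusion equation for the curvature on a moving metric *)

Section CurvatureFlow.

Variables (phi : R -> R -> R) (M : R).
Hypothesis g_per : per g.
Hypothesis g_pos : forall p t, 0 < g p t.
Hypothesis phi_smooth : Sm phi.
Hypothesis phi_per : per phi.
Hypothesis phi_zero : forall t, exists q, 0 <= q <= 1 /\ phi q t = 0.
Hypothesis phi_bound : forall p t, Rabs (phi p t) <= M.
Hypothesis dt_g : forall p t, dt g p t = phi p t ^ 2 / 2 * g p t.
Hypothesis dt_phi : forall p t,
  dt phi p t = / 2 * arcn g 2 phi p t + 2 * phi p t - / 2 * phi p t ^ 3.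

Notation ph k := (arcn g k phi).

Lemma Sm_ph k : Sm (ph k).
Proof. induction k; simpl; auto using Sm_arc. Qed.

Lemma per_ph k : per (ph k).
Proof. induction k; simpl; auto using per_arc, Sm_ph. Qed.

Lemma ph_zero k t : exists q, 0 <= q <= 1 /\ ph k q t = 0.
Proof.
destruct k as [|k]; [apply phi_zero|].
destruct (per_dp_zero (ph k) t (Sm_ph k) (per_ph k)) as [q [Hq Hz]].
exists q; split; [exact Hq|]; simpl; unfold arc; rewrite Hz; field; apply g_neq.
Qed.

(** The part of the evolution of phi_n other than the diffusion phi_(n+2) / 2. The subtracted term
    at each step is the commutator of [dt] with the arc-length derivative. *)
Fixpoint react (n : nat) : R -> R -> R :=
  match n with
  | O => fun p t => 2 * phi p t - / 2 * phi p t ^ 3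
  | S m => fun p t => arc g (react m) p t - phi p t ^ 2 / 2 * ph (S m) p t
  end.

Lemma Sm_react n : Sm (react n).
Proof.
induction n as [|n IH]; simpl react; [sm|].
assert (HS := Sm_ph (S n)); assert (HA := Sm_arc _ IH); sm.
Qed.

Lemma dt_ph k p t : dt (ph k) p t = / 2 * ph (S (S k)) p t + react k p t.
Proof.
revert p t; induction k as [|k IH]; intros p t.
- simpl ph; rewrite dt_phi; simpl; ring.
- change (ph (S k)) with (arc g (ph k)) at 1.
  rewrite dt_arc, dt_g by apply Sm_ph.
  replace (dt (ph k)) with (fun p t => / 2 * ph (S (S k)) p t + react k p t)
    by (extensionality a; extensionality b; symmetry; apply IH).
  rewrite (arc_plus (fun p t => / 2 * ph (S (S k)) p t)).
  + rewrite arc_scal; simpl; field; apply g_neq.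
  + apply Sm_mult; [apply Sm_const | apply Sm_ph].
  + apply Sm_react.
Qed.

(** The new monomial at each step comes from differentiating the coefficient 2 - (l + 4) / 2 * phi^2
    in front of phi_(l+1). *)
Fixpoint react_rest (m : nat) : dpoly :=
  match m with
  | O => DZero
  | S l => DAdd (DScale (- INR (l + 4)) (DMul (DVar 0) (DMul (DVar 1) (DVar (S l)))))
                (dder (react_rest l))
  end.

Lemma dord_react_rest m : dord m (react_rest m).
Proof.
induction m as [|m IH]; simpl; auto.
repeat split; auto with arith; apply dord_dder, IH.
Qed.

Let v (j : nat) : R -> R -> R := ph j.

Lemma Sm_deval P : Sm (deval v P).
Proof.
induction P; simpl; auto using Sm_const, Sm_plus, Sm_mult.
apply Sm_ph.
Qed.

Lemma arc_deval P : arc g (deval v P) = deval v (dder P).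
Proof.
induction P; extensionality p; extensionality t; simpl.
- apply arc_const.
- reflexivity.
- rewrite arc_plus, IHP1, IHP2 by apply Sm_deval; reflexivity.
- rewrite arc_mult, IHP1, IHP2 by apply Sm_deval; reflexivity.
- rewrite arc_scal, IHP; reflexivity.
Qed.

(** Isolates the top derivative, whose coefficient involves [phi] only. In (m + 4) / 2, the cubic
    term contributes 3 / 2 when first differentiated, and each of the m + 1 commutators adds 1 /
    2. *)
Lemma react_decomp m p t :
  react (S m) p t =
  (2 - INR (m + 4) / 2 * phi p t ^ 2) * ph (S m) p t + deval v (react_rest m) p t.
Proof.
revert p t; induction m as [|m IH]; intros p t.
- change (react 1 p t) with (arc g (react 0) p t - phi p t ^ 2 / 2 * ph 1 p t).
  replace (react 0) with
    (fun p t => 2 * phi p t + (- / 2) * (phi p t * (phi p t * phi p t)))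
    by (extensionality a; extensionality b; simpl; ring).
  rewrite arc_plus by sm.
  rewrite (arc_scal 2), (arc_scal (- / 2)).
  rewrite arc_mult, arc_mult by sm.
  change (arc g phi p t) with (ph 1 p t).
  simpl deval; simpl INR; field.
- change (react (S (S m)) p t)
    with (arc g (react (S m)) p t - phi p t ^ 2 / 2 * ph (S (S m)) p t).
  replace (react (S m)) with
    (fun p t => (2 + (- (INR (m + 4) / 2)) * (phi p t * phi p t)) * ph (S m) p t
                + deval v (react_rest m) p t)
    by (extensionality a; extensionality b; rewrite IH; ring).
  assert (S1 := Sm_ph (S m)).
  rewrite arc_plus by (try apply Sm_deval; sm).
  rewrite arc_mult by sm.
  rewrite (arc_plus (fun _ _ => 2)) by sm.
  rewrite arc_scal, arc_mult by sm.
  rewrite arc_deval.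
  rewrite arc_const.
  change (arc g (ph (S m)) p t) with (ph (S (S m)) p t).
  change (arc g phi p t) with (ph 1 p t).
  simpl deval; change (v 0 p t) with (phi p t); change (v 1 p t) with (ph 1 p t);
  change (v (S m) p t) with (ph (S m) p t).
  rewrite Nat.add_succ_l, S_INR; field.
Qed.

(** * Integration over the closed curve *)

Definition arcint (f : R -> R -> R) (t : R) : R := RInt (fun p => f p t * g p t) 0 1.

Lemma ex_arcint f t a b : Sm f -> ex_RInt (fun p => f p t * g p t) a b.
Proof.
intros Hf; apply (ex_RInt_continuous (fun p => f p t * g p t)); intros z _.
apply (Sm_continuous_p (fun p t => f p t * g p t)); sm.
Qed.

Lemma arcint_plus f h t : Sm f -> Sm h ->
  arcint (fun p t => f p t + h p t) t = arcint f t + arcint h t.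
Proof.
intros Hf Hh; unfold arcint.
transitivity (RInt (fun p => plus (f p t * g p t) (h p t * g p t)) 0 1).
- apply RInt_ext_real; intros p; unfold plus; simpl; ring.
- apply (RInt_plus (fun p => f p t * g p t)); apply ex_arcint; auto.
Qed.

Lemma arcint_scal c f t : Sm f -> arcint (fun p t => c * f p t) t = c * arcint f t.
Proof.
intros Hf; unfold arcint.
transitivity (RInt (fun p => scal c (f p t * g p t)) 0 1).
- apply RInt_ext_real; intros p; unfold scal; simpl; unfold mult; simpl; ring.
- apply (RInt_scal (fun p => f p t * g p t)); apply ex_arcint; auto.
Qed.

Lemma arcint_le f h t : Sm f -> Sm h -> (forall p, f p t <= h p t) ->
  arcint f t <= arcint h t.
Proof.
intros Hf Hh Hle; apply RInt_le; [lra | apply ex_arcint, Hf | apply ex_arcint, Hh |].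
intros p _; apply Rmult_le_compat_r; [apply Rlt_le, g_pos | apply Hle].
Qed.

Lemma arcint_nonneg f t : Sm f -> (forall p, 0 <= f p t) -> 0 <= arcint f t.
Proof.
intros Hf Hle; apply RInt_ge_0; [lra | apply ex_arcint, Hf |].
intros p _; apply Rmult_le_pos; [apply Hle | apply Rlt_le, g_pos].
Qed.

Lemma arcint_arc f t : Sm f -> per f -> arcint (arc g f) t = 0.
Proof.
intros Hf Pf; unfold arcint.
transitivity (RInt (Derive (fun q => f q t)) 0 1).
- apply RInt_ext_real; intros p; unfold arc, dp; field; apply g_neq.
- rewrite RInt_Derive.
  + specialize (Pf 0 t); rewrite Rplus_0_l in Pf; simpl; lra.
  + intros p _; apply Sm_ex_derive_p, Hf.
  + intros p _; apply (Sm_continuous_p (dp f)), Sm_dp, Hf.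
Qed.

(** The term with phi^2 / 2 is the growth of the length element. *)
Lemma arcint_derive f t : Sm f ->
  is_derive (arcint f) t (arcint (fun p t => dt f p t + phi p t ^ 2 / 2 * f p t) t).
Proof.
intros Hf.
assert (Sfg : Sm (fun p t => f p t * g p t)) by sm.
assert (H : is_derive (arcint f) t
              (RInt (fun p => Derive (fun u => f p u * g p u) t) 0 1)).
{ apply (is_derive_RInt_param (fun u p => f p u * g p u)).
  - exists (mkposreal 1 Rlt_0_1); intros s _ p _; apply (Sm_ex_derive_t _ p s Sfg).
  - intros p _.
    apply continuity_2d_pt_filterlim.
    apply (continuous_comp_2 (fun z : R * R => snd z) (fun z : R * R => fst z)
             (fun a b => dt (fun p t => f p t * g p t) a b) (t, p)).
    + apply continuous_snd.
    + apply continuous_fst.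
    + apply (Cn_cont 0), (Sm_dt _ Sfg).
  - exists (mkposreal 1 Rlt_0_1); intros s _; apply ex_arcint, Hf. }
replace (arcint (fun p t => dt f p t + phi p t ^ 2 / 2 * f p t) t)
  with (RInt (fun p => Derive (fun u => f p u * g p u) t) 0 1); [exact H|].
apply RInt_ext_real; intros p.
change (Derive (fun u => f p u * g p u) t) with (dt (fun p t => f p t * g p t) p t).
rewrite dt_mult, dt_g by assumption; ring.
Qed.

(* With [F p] the integral of [f^2 + f_xi^2] over [0,p], both [F - f^2] and
   [F + f^2] are nondecreasing in [p]; compare with the zero of [f]. *)
Lemma sup_le_arcint f p t q : Sm f -> per f -> 0 <= q <= 1 -> f q t = 0 ->
  f p t ^ 2 <= arcint (fun p t => f p t ^ 2 + arc g f p t ^ 2) t.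
Proof.
intros Hf Pf Hq Hz.
destruct (per_reduce f Pf p) as [r [Hr ->]].
set (w := fun p t => f p t ^ 2 + arc g f p t ^ 2).
assert (Sw : Sm w) by (assert (H := Sm_arc f Hf); unfold w; sm).
set (F := fun b => RInt (fun p => w p t * g p t) 0 b).
assert (F1 : arcint w t = F 1) by reflexivity.
assert (F0 : F 0 = 0) by (unfold F; apply (RInt_point 0 (fun p => w p t * g p t))).
assert (DF : forall s, is_derive F s (w s t * g s t)).
{ intros s; apply (is_derive_RInt (fun p => w p t * g p t) F 0 s).
  - exists (mkposreal 1 Rlt_0_1); intros b _.
    apply (RInt_correct (fun p => w p t * g p t)), ex_arcint, Sw.
  - apply (Sm_continuous_p (fun p t => w p t * g p t)); sm. }
assert (Dsq : forall s, is_derive (fun q => f q t ^ 2) s (2 * f s t * arc g f s t * g s t)).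
{ intros s; auto_derive; [apply (Sm_ex_derive_p f), Hf|].
  unfold arc, dp; field; apply g_neq. }
assert (Hw : forall s, 0 <= w s t).
{ intros s; unfold w; assert (H1 := pow2_ge_0 (f s t)).
  assert (H2 := pow2_ge_0 (arc g f s t)); lra. }
assert (MF : forall a b, a <= b -> F a <= F b).
{ intros a b Hab; apply (derive_nonneg_le F (fun s => w s t * g s t)); auto.
  intros s _; apply Rmult_le_pos; [apply Hw | apply Rlt_le, g_pos]. }
rewrite F1.
assert (M0 := MF 0 (Rmin q r) ltac:(apply Rmin_glb; lra)).
assert (M1 := MF (Rmax q r) 1 ltac:(apply Rmax_lub; lra)).
destruct (Rle_or_lt q r) as [Hqr|Hqr].
- rewrite Rmin_left in M0 by lra; rewrite Rmax_right in M1 by lra.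
  assert (H : F q - f q t ^ 2 <= F r - f r t ^ 2).
  { apply (derive_nonneg_le (fun s => F s - f s t ^ 2)
             (fun s => w s t * g s t - 2 * f s t * arc g f s t * g s t)); [lra| |].
    - intros s _; apply (is_derive_minus F (fun s => f s t ^ 2)); auto.
    - intros s _; replace (_ - _) with ((f s t - arc g f s t) ^ 2 * g s t)
        by (unfold w; ring).
      apply Rmult_le_pos; [apply pow2_ge_0 | apply Rlt_le, g_pos]. }
  rewrite Hz in H; nra.
- rewrite Rmin_right in M0 by lra; rewrite Rmax_left in M1 by lra.
  assert (H : F r + f r t ^ 2 <= F q + f q t ^ 2).
  { apply (derive_nonneg_le (fun s => F s + f s t ^ 2)
             (fun s => w s t * g s t + 2 * f s t * arc g f s t * g s t)); [lra| |].
    - intros s _; apply (is_derive_plus F (fun s => f s t ^ 2)); auto.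
    - intros s _; replace (_ + _) with ((f s t + arc g f s t) ^ 2 * g s t)
        by (unfold w; ring).
      apply Rmult_le_pos; [apply pow2_ge_0 | apply Rlt_le, g_pos]. }
  rewrite Hz in H; nra.
Qed.

(** * Energy estimates and decay of the curvature *)

Definition energy (k : nat) : R -> R := arcint (fun p t => ph k p t ^ 2).

Lemma energy_nonneg k t : 0 <= energy k t.
Proof.
apply arcint_nonneg; [|intros p; apply pow2_ge_0].
assert (H := Sm_ph k); sm.
Qed.

Lemma ph_sq_le k p t : ph k p t ^ 2 <= energy k t + energy (S k) t.
Proof.
destruct (ph_zero k t) as [q [Hq Hz]].
eapply Rle_trans; [apply (sup_le_arcint (ph k) p t q); auto using Sm_ph, per_ph|].
apply Req_le, arcint_plus.
- assert (H := Sm_ph k); sm.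
- assert (H := Sm_ph (S k)); apply (Sm_pow (ph (S k))), H.
Qed.

Lemma uvanishes_ph k : vanishes (energy k) -> vanishes (energy (S k)) -> uvanishes (ph k).
Proof.
intros H0 H1 eps He.
destruct (vanishes_plus _ _ H0 H1 (eps ^ 2)) as [T HT]; [apply pow_lt, He|].
exists T; intros t p Ht; specialize (HT t Ht); apply Rabs_def2 in HT.
assert (H := ph_sq_le k p t).
rewrite <- (Rabs_pos_eq eps) by lra; apply Rsqr_lt_abs_0.
unfold Rsqr; simpl in HT, H; lra.
Qed.

Lemma energy_derive k t :
  is_derive (energy k) t
    (arcint (fun p t => 2 * ph k p t * (/ 2 * ph (S (S k)) p t + react k p t)
                        + phi p t ^ 2 / 2 * ph k p t ^ 2) t).
Proof.
assert (H := Sm_ph k).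
assert (H2 : Sm (fun p t => ph k p t ^ 2)) by sm.
assert (HD := arcint_derive _ t H2).
replace (fun p t => 2 * ph k p t * (/ 2 * ph (S (S k)) p t + react k p t)
                        + phi p t ^ 2 / 2 * ph k p t ^ 2)
  with (fun p t => dt (fun p t => ph k p t ^ 2) p t + phi p t ^ 2 / 2 * ph k p t ^ 2);
  [exact HD|].
extensionality p; extensionality s; f_equal.
rewrite <- dt_ph.
apply is_derive_unique; auto_derive; [apply (Sm_ex_derive_t (ph k)), H|].
unfold dt; ring.
Qed.

(** The cubic reaction gives -phi^4 and the length element +phi^4 / 2; their sum has a favourable
    sign and is dropped. The 4 is twice the linear coefficient 2 of the reaction. *)
Lemma energy0_derive_le t : Derive (energy 0) t <= - energy 1 t + 4 * energy 0 t.
Proof.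
rewrite (is_derive_unique _ _ _ (energy_derive 0 t)).
assert (H0 := Sm_ph 0); assert (H1 := Sm_ph 1); assert (H2 := Sm_ph 2).
assert (R0 := Sm_react 0).
set (div := fun p t => arc g (fun p t => ph 0 p t * ph 1 p t) p t).
assert (Sdiv : Sm div) by (apply Sm_arc; sm).
transitivity (arcint (fun p t => div p t + (-1 * ph 1 p t ^ 2 + 4 * ph 0 p t ^ 2)) t).
- apply arcint_le; [sm | sm |].
  intros p; unfold div; rewrite arc_mult by assumption.
  change (arc g (ph 0) p t) with (ph 1 p t); change (arc g (ph 1) p t) with (ph 2 p t).
  change (react 0 p t) with (2 * phi p t - / 2 * phi p t ^ 3).
  change (ph 0 p t) with (phi p t).
  assert (Hsq := pow2_ge_0 (phi p t ^ 2)); nra.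
- rewrite arcint_plus, arcint_plus, arcint_scal, arcint_scal by sm.
  unfold div; rewrite (arcint_arc (fun p t => ph 0 p t * ph 1 p t)).
  + unfold energy; lra.
  + sm.
  + intros p s; f_equal; apply per_ph.
Qed.

(* Moving one derivative off the reaction term by parts lets half of the
   dissipation absorb it. *)
Lemma energyS_derive_le n t :
  Derive (energy (S n)) t <=
  - (/ 2 * energy (S (S n)) t) + 2 * arcint (fun p t => react n p t ^ 2) t.
Proof.
rewrite (is_derive_unique _ _ _ (energy_derive (S n) t)).
assert (H1 := Sm_ph (S n)); assert (H2 := Sm_ph (S (S n))).
assert (H3 := Sm_ph (S (S (S n)))); assert (Rn := Sm_react n); assert (Rn' := Sm_react (S n)).
(* The integrand is phi_(n+1) times the arc-length derivative of [u], minus phi^2 phi_(n+1)^2 / 2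
   left by the commutator and the length element. *)
set (u := fun p t => ph (S (S n)) p t + 2 * react n p t).
assert (Su : Sm u) by (unfold u; sm).
set (div := fun p t => arc g (fun p t => ph (S n) p t * u p t) p t).
assert (Sdiv : Sm div) by (apply Sm_arc; sm).
transitivity (arcint (fun p t => div p t +
   ((- / 2) * ph (S (S n)) p t ^ 2 + 2 * react n p t ^ 2)) t).
- apply arcint_le; [sm | sm |].
  intros p; unfold div; rewrite arc_mult by assumption.
  unfold u; rewrite (arc_plus (ph (S (S n))) (fun p t => 2 * react n p t)) by sm.
  rewrite arc_scal.
  change (arc g (ph (S n)) p t) with (ph (S (S n)) p t).
  change (arc g (ph (S (S n))) p t) with (ph (S (S (S n))) p t).
  change (react (S n) p t) with (arc g (react n) p t - phi p t ^ 2 / 2 * ph (S n) p t).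
  assert (Hsq1 := pow2_ge_0 (phi p t * ph (S n) p t)).
  (* Half of this square is the Young inequality that splits the cross term between dissipation and
     reaction. *)
  assert (Hsq2 := pow2_ge_0 (ph (S (S n)) p t + 2 * react n p t)).
  nra.
- rewrite arcint_plus, arcint_plus, arcint_scal, arcint_scal by sm.
  unfold div; rewrite (arcint_arc (fun p t => ph (S n) p t * u p t)).
  + unfold energy; lra.
  + sm.
  + assert (PR : forall m, per (react m)).
    { induction m as [|m IH]; intros p s; cbn [react].
      - rewrite phi_per; reflexivity.
      - rewrite (per_arc _ g_per (Sm_react m) IH), phi_per, (per_ph (S m)); reflexivity. }
    intros p s; unfold u; rewrite (per_ph (S n)), (per_ph (S (S n))), PR; reflexivity.
Qed.

Lemma length_derive t : is_derive (arcint (fun _ _ => 1)) t (/ 2 * energy 0 t).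
Proof.
assert (H := arcint_derive (fun _ _ => 1) t (Sm_const 1)).
replace (/ 2 * energy 0 t)
  with (arcint (fun p t => dt (fun _ _ => 1) p t + phi p t ^ 2 / 2 * 1) t); [exact H|].
unfold energy; rewrite <- arcint_scal by sm.
apply RInt_ext_real; intros p; rewrite dt_const; simpl; field.
Qed.

Lemma length_nonneg t : 0 <= arcint (fun _ _ => 1) t.
Proof. apply arcint_nonneg; [apply Sm_const | intros; lra]. Qed.

Lemma energy0_window : window_vanishes (energy 0).
Proof.
apply (bounded_primitive_window (fun t => 2 * arcint (fun _ _ => 1) t) _ 0).
- intros t; replace (energy 0 t) with (2 * (/ 2 * energy 0 t)) by field.
  apply is_derive_scal, length_derive.
- apply energy_nonneg.
- intros t; assert (H := length_nonneg t); lra.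
Qed.

Lemma length_le_0 t : t <= 0 -> arcint (fun _ _ => 1) t <= arcint (fun _ _ => 1) 0.
Proof.
intros Ht; apply (derive_nonneg_le _ (fun t => / 2 * energy 0 t)); [exact Ht| |].
- intros s _; apply length_derive.
- intros s _; assert (H := energy_nonneg 0 s); lra.
Qed.

Lemma arcint_sq_vanishes w : Sm w -> uvanishes w -> vanishes (arcint (fun p t => w p t ^ 2)).
Proof.
intros Sw Uw eps He.
set (L0 := arcint (fun _ _ => 1) 0).
assert (HL0 : 0 <= L0) by apply length_nonneg.
(* With [d] at most 1, |w| < d gives w^2 <= d; the [+ 1] keeps the denominator positive and the
   final inequality strict. *)
set (d := Rmin 1 (eps / (L0 + 1))).
assert (Hd : 0 < d <= 1).
{ split; [|apply Rmin_l]; apply Rmin_glb_lt; [lra | apply Rdiv_lt_0_compat; lra]. }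
assert (Hde : d * (L0 + 1) <= eps).
{ transitivity (eps / (L0 + 1) * (L0 + 1)).
  - apply Rmult_le_compat_r; [lra | apply Rmin_r].
  - apply Req_le; field; lra. }
destruct (Uw d) as [T HT]; [lra|].
exists (Rmin 0 T); intros t Ht.
assert (Ht0 := Rle_trans _ _ _ Ht (Rmin_l _ _)).
assert (HtT := Rle_trans _ _ _ Ht (Rmin_r _ _)).
rewrite Rabs_pos_eq by (apply arcint_nonneg; [sm | intros p; apply pow2_ge_0]).
assert (H : arcint (fun p t => w p t ^ 2) t <= d * arcint (fun _ _ => 1) t).
{ rewrite <- arcint_scal by sm; apply arcint_le; [sm | sm |].
  intros p; specialize (HT t p HtT); apply Rabs_def2 in HT; nra. }
assert (HL := length_le_0 t Ht0); fold L0 in HL; nra.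
Qed.

(** Here the bound [M] enters: phi_n is known to be small only in energy, so its coefficient must be
    bounded. The remaining terms have order below n, where consecutive vanishing energies give
    uniform smallness. *)
Lemma arcint_react_vanishes n :
  vanishes (energy n) -> (forall j, (S j <= n)%nat -> vanishes (energy j)) ->
  vanishes (arcint (fun p t => react n p t ^ 2)).
Proof.
intros Hn Hlt.
assert (Sn := Sm_ph n); assert (Rn := Sm_react n).
assert (Hw : exists c w, 0 <= c /\ Sm w /\ uvanishes w /\ forall p t,
   react n p t = (2 - c * phi p t ^ 2) * ph n p t + w p t).
{ destruct n as [|m].
  - exists (/ 2), (deval v DZero); repeat split; [lra | apply Sm_deval | | ].
    + intros eps He; exists 0; intros t p _; simpl; rewrite Rabs_R0; exact He.
    + intros p t; simpl; ring.
  - exists (INR (m + 4) / 2), (deval v (react_rest m)); repeat split.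
    + assert (H := pos_INR (m + 4)); lra.
    + apply Sm_deval.
    + apply (uvanishes_deval _ m); [|apply dord_react_rest].
      intros j Hj; apply uvanishes_ph.
      * apply Hlt; lia.
      * destruct (Nat.eq_dec j m) as [->|Hne]; [exact Hn|apply Hlt; lia].
    + intros p t; apply react_decomp. }
destruct Hw as [c [w [Hc [Sw [Uw Hw]]]]].
set (K := 2 + c * M ^ 2).
assert (HK : forall p t, (2 - c * phi p t ^ 2) ^ 2 <= K ^ 2).
{ intros p t; apply pow_maj_Rabs.
  assert (Hsq : 0 <= phi p t ^ 2 <= M ^ 2).
  { split; [apply pow2_ge_0 | apply pow_maj_Rabs, phi_bound]. }
  unfold K; apply Rabs_le; nra. }
(* From (a + b)^2 <= 2 a^2 + 2 b^2. *)
apply (vanishes_le _ (fun t => (2 * K ^ 2) * energy n t + 2 * arcint (fun p t => w p t ^ 2) t)).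
- apply vanishes_plus; apply vanishes_scal; [exact Hn | apply arcint_sq_vanishes; assumption].
- exists 0; intros t _; split.
  { apply arcint_nonneg; [sm | intros p; apply pow2_ge_0]. }
  unfold energy; rewrite <- arcint_scal, <- arcint_scal, <- arcint_plus by sm.
  apply arcint_le; [sm | sm |].
  intros p; rewrite Hw; specialize (HK p t).
  set (al := 2 - c * phi p t ^ 2) in *.
  assert (H1 := pow2_ge_0 (al * ph n p t - w p t)).
  assert (H2 := Rmult_le_compat_r _ _ _ (pow2_ge_0 (ph n p t)) HK); nra.
Qed.

Lemma continuous_energy k t : continuous (energy k) t.
Proof. apply (ex_derive_continuous (energy k)); eexists; apply energy_derive. Qed.

(** [energy_step] needs a vanishing window at order k, and its error term needs vanishing energies
    strictly below k; it returns both for k + 1. *)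
Lemma energy_vanishes_upto k :
  window_vanishes (energy k) /\ forall j, (S j <= k)%nat -> vanishes (energy j).
Proof.
induction k as [|k [Wk Vlt]].
- split; [apply energy0_window | intros j Hj; lia].
- assert (H : vanishes (energy k) /\ window_vanishes (energy (S k))).
  (* The growth constant 4 is dictated by order 0; at higher orders the nonnegative term
     [4 * energy] is merely added on the right. *)
  { apply (energy_step _ _ 4); [lra | apply energy_nonneg | apply energy_nonneg | | | | exact Wk].
    - intros t; eexists; apply energy_derive.
    - apply continuous_energy.
    - destruct k as [|n].
      + intros eps He; exists 0; intros t _.
        assert (H0 := energy0_derive_le t); assert (H1 := energy_nonneg 1 t); lra.
      + intros eps He.
        assert (V := arcint_react_vanishes n (Vlt n (Nat.le_refl _))
                       (fun j Hj => Vlt j (le_S _ _ Hj))).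
        destruct (V (eps / 2)) as [T HT]; [lra|].
        exists T; intros t Ht; specialize (HT t Ht); apply Rabs_def2 in HT.
        assert (H0 := energyS_derive_le n t); assert (H1 := energy_nonneg (S n) t); lra. }
  destruct H as [Vk WSk]; split; [exact WSk|].
  intros j Hj; destruct (Nat.eq_dec j k) as [->|Hne]; [exact Vk | apply Vlt; lia].
Qed.

Lemma curvature_derivatives_vanish k : uvanishes (ph k).
Proof.
(* The sup bound uses the energies of orders k and k + 1, both strictly below k + 2. *)
apply uvanishes_ph; apply (energy_vanishes_upto (S (S k))); lia.
Qed.

End CurvatureFlow.

End ArcLength.

(** * Centro-affine geometry of a closed curve *)

Section ClosedCurve.

Variables x y : R -> R -> R.
Hypothesis x_smooth : Sm x.
Hypothesis y_smooth : Sm y.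
Hypothesis x_per : per x.
Hypothesis y_per : per y.
Hypothesis radial_neq : forall p t, br (x p t) (y p t) (dp x p t) (dp y p t) <> 0.
Hypothesis convex_neq :
  forall p t, br (dp x p t) (dp y p t) (dp (dp x) p t) (dp (dp y) p t) <> 0.

Let m p t := br (x p t) (y p t) (dp x p t) (dp y p t).
Let n p t := br (dp x p t) (dp y p t) (dp (dp x) p t) (dp (dp y) p t).

Let m_smooth : Sm m.
Proof. unfold m, br; sm. Qed.

Let n_smooth : Sm n.
Proof. unfold n, br; sm. Qed.

Let quotient_smooth : Sm (fun p t => n p t / m p t).
Proof. sm; exact radial_neq. Qed.

(* Rolle for the periodic function [(|C|^2)_p / [C, C_p]]: its derivative has
   the numerator [2 ([C, C_p] |C_p|^2 - [C_p, C_pp] |C|^2)]. *)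
Lemma quotient_pos_somewhere t : exists q, 0 < n q t / m q t.
Proof.
set (f := fun p t => (x p t * dp x p t + y p t * dp y p t) / m p t).
assert (Sf : Sm f) by (unfold f; sm; exact radial_neq).
assert (Pf : per f).
{ intros p s; unfold f, m.
  rewrite (per_dp x x_smooth x_per), (per_dp y y_smooth y_per), x_per, y_per; reflexivity. }
destruct (per_dp_zero f t Sf Pf) as [q [_ Hq]].
exists q.
assert (Hm := radial_neq q t); fold (m q t) in Hm.
assert (Df : m q t * (dp x q t ^ 2 + dp y q t ^ 2) =
             n q t * (x q t ^ 2 + y q t ^ 2)).
{ unfold f in Hq; rewrite dp_div in Hq by (assumption || sm).
  apply (Rmult_eq_compat_r (m q t ^ 2)) in Hq.
  unfold Rdiv in Hq; rewrite Rmult_assoc, Rinv_l, Rmult_0_l, Rmult_1_r in Hq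
    by (apply pow_nonzero, Hm).
  rewrite dp_plus, !dp_mult in Hq by sm.
  unfold m at 2, br in Hq; rewrite dp_minus, !dp_mult in Hq by sm.
  unfold m, n, br in *; lra. }
assert (Hz : 0 < x q t ^ 2 + y q t ^ 2).
{ assert (H1 := pow2_ge_0 (x q t)); assert (H2 := pow2_ge_0 (y q t)).
  destruct (Rle_lt_or_eq_dec 0 (x q t ^ 2 + y q t ^ 2)) as [H|H]; [lra | exact H |].
  exfalso; apply Hm; unfold m, br.
  assert (Hx : x q t = 0) by nra; assert (Hy : y q t = 0) by nra.
  rewrite Hx, Hy; ring. }
assert (Hn := convex_neq q t); fold (n q t) in Hn.
(* At the Rolle point n / m is |C_p|^2 / |C|^2, which is nonzero because C_p = 0 would make [n]
   vanish. *)
assert (E : n q t / m q t * (x q t ^ 2 + y q t ^ 2) = dp x q t ^ 2 + dp y q t ^ 2).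
{ apply (Rmult_eq_reg_l (m q t)); [|exact Hm]; rewrite Df; field; exact Hm. }
assert (Hne : n q t / m q t <> 0).
{ intros H; rewrite H, Rmult_0_l in E; apply Hn; unfold n, br.
  assert (Hx : dp x q t = 0) by nra; assert (Hy : dp y q t = 0) by nra.
  rewrite Hx, Hy; ring. }
assert (H1 := pow2_ge_0 (dp x q t)); assert (H2 := pow2_ge_0 (dp y q t)).
nra.
Qed.

(** The quotient is continuous in p and never zero, so positivity at one point spreads. Hence [sqrt]
    in [cametric] never returns its default value 0 for a negative argument. *)
Lemma quotient_pos p t : 0 < n p t / m p t.
Proof.
destruct (quotient_pos_somewhere t) as [q Hq].
destruct (Rlt_le_dec 0 (n p t / m p t)) as [H|H]; [exact H|exfalso].
destruct (IVT_gen (fun q => n q t / m q t) p q 0) as [r [_ Hr]].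
- intros s; apply continuity_pt_filterlim.
  apply (Sm_continuous_p (fun p t => n p t / m p t)), quotient_smooth.
- split.
  + eapply Rle_trans; [apply Rmin_l | exact H].
  + eapply Rle_trans; [apply Rlt_le, Hq | apply Rmax_r].
- apply (convex_neq r t); fold (n r t).
  apply (Rmult_eq_reg_r (/ m r t)); [rewrite Rmult_0_l; exact Hr|].
  apply Rinv_neq_0_compat, radial_neq.
Qed.

(** * Metric, moving frame and curvature *)

Let g := cametric x y.
Let phi := caphi x y.

Lemma cametric_pos p t : 0 < g p t.
Proof. apply sqrt_lt_R0, quotient_pos. Qed.

Lemma cametric_neq p t : g p t <> 0.
Proof. apply Rgt_not_eq, cametric_pos. Qed.

Lemma cametric_sq p t : g p t * g p t * m p t = n p t.
Proof.
unfold g, cametric; fold (m p t) (n p t).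
rewrite sqrt_sqrt by apply Rlt_le, quotient_pos; field; apply radial_neq.
Qed.

Lemma Sm_cametric : Sm g.
Proof. apply (Sm_sqrt (fun p t => n p t / m p t)); auto using quotient_pos. Qed.

Lemma per_cametric : per g.
Proof.
intros p t; unfold g, cametric.
assert (Px := per_dp x x_smooth x_per); assert (Py := per_dp y y_smooth y_per).
rewrite (per_dp (dp x)), (per_dp (dp y)), Px, Py, x_per, y_per by (auto using Sm_dp).
reflexivity.
Qed.

Let Sm_arcg f : Sm f -> Sm (arc g f).
Proof. apply Sm_arc; [apply Sm_cametric | apply cametric_neq]. Qed.

Let per_arcg f : Sm f -> per f -> per (arc g f).
Proof. apply per_arc, per_cametric. Qed.

Lemma frame_det p t : (x p t * arc g y p t - y p t * arc g x p t) * g p t = m p t.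
Proof. unfold arc, m, br; field; apply cametric_neq. Qed.

Lemma frame_neq p t : x p t * arc g y p t - y p t * arc g x p t <> 0.
Proof.
intros H; apply (radial_neq p t); fold (m p t).
rewrite <- frame_det, H; ring.
Qed.

Lemma caphi_eq p t : phi p t =
  br (arc g (arc g x) p t) (arc g (arc g y) p t) (x p t) (y p t)
  / br (arc g x p t) (arc g y p t) (x p t) (y p t).
Proof. reflexivity. Qed.

Lemma br_frame_neq p t : br (arc g x p t) (arc g y p t) (x p t) (y p t) <> 0.
Proof. assert (H := frame_neq p t); unfold br; lra. Qed.

Lemma Sm_caphi : Sm phi.
Proof.
assert (S1 := Sm_arcg x x_smooth); assert (S2 := Sm_arcg y y_smooth).
assert (S3 := Sm_arcg _ S1); assert (S4 := Sm_arcg _ S2).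
apply Sm_div; [unfold br; sm | unfold br; sm | apply br_frame_neq].
Qed.

Lemma per_caphi : per phi.
Proof.
intros p t; rewrite !caphi_eq.
rewrite !(per_arcg (arc g x)), !(per_arcg (arc g y)), !(per_arcg x), !(per_arcg y), x_per, y_per
  by auto.
reflexivity.
Qed.

(** The normalisation that defines the arc-length: the two sides are n / g^3 and m / g, and g^2 = n
    / m. The derivative of [g] drops out of the determinant. *)
Lemma second_frame_det p t :
  arc g x p t * arc g (arc g y) p t - arc g y p t * arc g (arc g x) p t =
  x p t * arc g y p t - y p t * arc g x p t.
Proof.
assert (Hg := cametric_neq p t).
apply (Rmult_eq_reg_r (g p t)); [|exact Hg]; rewrite frame_det.
apply (Rmult_eq_reg_r (g p t * g p t)); [|apply Rmult_integral_contrapositive; auto].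
transitivity (n p t); [|rewrite <- cametric_sq; ring].
assert (A2 : forall z, Sm z -> arc g (arc g z) p t =
  (dp (dp z) p t * g p t - dp z p t * dp g p t) / g p t ^ 3).
{ intros z Sz; unfold arc at 1.
  change (arc g z) with (fun p t => dp z p t / g p t).
  rewrite dp_div by (auto using Sm_dp, Sm_cametric, cametric_neq); field; exact Hg. }
rewrite !A2 by assumption.
unfold arc, n, br; field; exact Hg.
Qed.

(** Cramer's rule in the frame (C, C_xi): the coefficient of C is -1 by [second_frame_det], and that
    of C_xi is the definition of the curvature. *)
Lemma arc2_frame_x p t : arc g (arc g x) p t = - x p t + phi p t * arc g x p t.
Proof.
assert (Hd := br_frame_neq p t).
assert (H := f_equal (Rmult (x p t)) (second_frame_det p t)).
apply (Rmult_eq_reg_r (br (arc g x p t) (arc g y p t) (x p t) (y p t))); [|exact Hd].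
transitivity (- x p t * br (arc g x p t) (arc g y p t) (x p t) (y p t) +
  br (arc g (arc g x) p t) (arc g (arc g y) p t) (x p t) (y p t) * arc g x p t).
- unfold br; lra.
- rewrite caphi_eq; field; exact Hd.
Qed.

Lemma arc2_frame_y p t : arc g (arc g y) p t = - y p t + phi p t * arc g y p t.
Proof.
assert (Hd := br_frame_neq p t).
assert (H := f_equal (Rmult (y p t)) (second_frame_det p t)).
apply (Rmult_eq_reg_r (br (arc g x p t) (arc g y p t) (x p t) (y p t))); [|exact Hd].
transitivity (- y p t * br (arc g x p t) (arc g y p t) (x p t) (y p t) +
  br (arc g (arc g x) p t) (arc g (arc g y) p t) (x p t) (y p t) * arc g y p t).
- unfold br; lra.
- rewrite caphi_eq; field; exact Hd.
Qed.

(* [phi] is the logarithmic arc-length derivative of the periodic function [C, C_xi]. *)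
Lemma caphi_zero t : exists q, 0 <= q <= 1 /\ phi q t = 0.
Proof.
set (w := fun p t => x p t * arc g y p t - y p t * arc g x p t).
assert (S1 := Sm_arcg x x_smooth); assert (S2 := Sm_arcg y y_smooth).
assert (Sw : Sm w) by (unfold w; sm).
assert (Pw : per w).
{ intros p s; unfold w; rewrite (per_arcg x), (per_arcg y), x_per, y_per by auto; reflexivity. }
destruct (per_dp_zero w t Sw Pw) as [q [Hq Hz]].
exists q; split; [exact Hq|].
apply (Rmult_eq_reg_r (w q t)); [|apply frame_neq].
assert (Aw : forall f, dp f q t = arc g f q t * g q t)
  by (intros f; unfold arc; field; apply cametric_neq).
unfold w in Hz at 1; rewrite dp_minus, !dp_mult, !Aw, arc2_frame_x, arc2_frame_y in Hz by sm.
assert (Hg := cametric_neq q t).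
apply (Rmult_eq_reg_r (g q t)); [|exact Hg].
unfold w; lra.
Qed.

Lemma arc_integral_curvature lam p t :
  arc g (fun p t => lam + intphi x y p t) p t = phi p t.
Proof.
assert (Sfg : Sm (fun p t => phi p t * g p t)).
{ assert (H1 := Sm_caphi); assert (H2 := Sm_cametric); sm. }
assert (D1 : is_derive (fun q => intphi x y q t) p (phi p t * g p t)).
{ apply (is_derive_RInt (fun q => phi q t * g q t) (fun q => intphi x y q t) 0 p).
  - exists (mkposreal 1 Rlt_0_1); intros b _.
    apply (RInt_correct (fun q => phi q t * g q t)).
    apply (ex_RInt_continuous (fun q => phi q t * g q t)); intros z _.
    apply (Sm_continuous_p _ z t Sfg).
  - apply (Sm_continuous_p _ p t Sfg). }
unfold arc, dp.
replace (Derive (fun q => lam + intphi x y q t) p) with (phi p t * g p t).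
- field; apply cametric_neq.
- symmetry; apply is_derive_unique.
  replace (phi p t * g p t) with (0 + phi p t * g p t) by ring.
  apply (is_derive_plus (fun _ => lam) (fun q => intphi x y q t)); [|exact D1].
  apply (is_derive_const lam).
Qed.

(* The flow equation exhibits the non-local speed as a quotient of smooth functions,
   which avoids differentiating the integral in [t]. *)
Lemma Sm_integral_curvature lam :
  (forall p t, dt x p t = (lam + intphi x y p t) * x p t + phi p t / 2 * arc g x p t) ->
  (forall p t, dt y p t = (lam + intphi x y p t) * y p t + phi p t / 2 * arc g y p t) ->
  Sm (fun p t => lam + intphi x y p t).
Proof.
intros Hx Hy.
assert (S1 := Sm_arcg x x_smooth); assert (S2 := Sm_arcg y y_smooth).
replace (fun p t => lam + intphi x y p t) with
  (fun p t => (dt x p t * arc g y p t - dt y p t * arc g x p t)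
              / (x p t * arc g y p t - y p t * arc g x p t)).
- apply Sm_div; [sm | sm | apply frame_neq].
- extensionality p; extensionality t; rewrite Hx, Hy; field; apply frame_neq.
Qed.

End ClosedCurve.

Lemma dxin_arcn x y k f : dxin x y k f = arcn (cametric x y) k f.
Proof. induction k as [|k IH]; [reflexivity|]; simpl; rewrite IH; reflexivity. Qed.

Theorem theorem1p2 (x y : R -> R -> R) (lam : R) :
  (* smooth family of closed curves (p has period 1) *)
  smooth2 x -> smooth2 y ->
  (forall p t, x (p + 1) t = x p t /\ y (p + 1) t = y p t) ->
  (* embedded: injective on one period *)
  (forall t p q, 0 <= p < 1 -> 0 <= q < 1 ->
     x p t = x q t -> y p t = y q t -> p = q) ->
  (* standing nondegeneracy / (strict) convexity conditions *)
  (forall p t, br (x p t) (y p t) (dp x p t) (dp y p t) <> 0) ->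
  (forall p t, br (dp x p t) (dp y p t) (dp (dp x) p t) (dp (dp y) p t) <> 0) ->
  (* the flow C_t = (lam + int_0^xi phi dxi) C + (phi/2) C_xi *)
  (forall p t,
     dt x p t = (lam + intphi x y p t) * x p t + caphi x y p t / 2 * dxi x y x p t /\
     dt y p t = (lam + intphi x y p t) * y p t + caphi x y p t / 2 * dxi x y y p t) ->
  (* phi uniformly bounded on S^1 x R *)
  (exists M, forall p t, Rabs (caphi x y p t) <= M) ->
  (* phi -> 0 smoothly as t -> -oo: every xi-derivative tends to 0 uniformly *)
  forall (k : nat) (eps : R), 0 < eps ->
    exists T, forall t p, t <= T -> Rabs (dxin x y k (caphi x y) p t) < eps.
Proof.
intros Hx Hy Hper _ Hm Hn Hflow [M HM].
assert (Sx := smooth2_Sm x Hx); assert (Sy := smooth2_Sm y Hy).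
assert (Px : per x) by (intros p t; apply Hper).
assert (Py : per y) by (intros p t; apply Hper).
set (g := cametric x y); set (phi := caphi x y).
assert (Sg : Sm g) by (apply Sm_cametric; assumption).
assert (Ng : forall p t, g p t <> 0) by (apply cametric_neq; assumption).
assert (Sphi : Sm phi) by (apply Sm_caphi; assumption).
assert (fx := fun p t => proj1 (Hflow p t)); assert (fy := fun p t => proj2 (Hflow p t)).
assert (SU : Sm (fun p t => lam + intphi x y p t)) by (apply Sm_integral_curvature; assumption).
assert (ax : forall p t, arc g (arc g x) p t = - x p t + phi p t * arc g x p t)
  by (apply arc2_frame_x; assumption).
assert (ay : forall p t, arc g (arc g y) p t = - y p t + phi p t * arc g y p t)
  by (apply arc2_frame_y; assumption).
assert (fr : forall p t, x p t * arc g y p t - y p t * arc g x p t <> 0)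
  by (apply frame_neq; assumption).
assert (aU : forall p t, arc g (fun p t => lam + intphi x y p t) p t = phi p t)
  by (apply arc_integral_curvature; assumption).
intros k; rewrite dxin_arcn.
(* From here the curve is eliminated: only periodicity, the zero of [phi], its bound and the two
   evolution laws remain. *)
apply (curvature_derivatives_vanish g Sg Ng phi M); try assumption.
- apply per_cametric; assumption.
- apply cametric_pos; assumption.
- apply per_caphi; assumption.
- apply caphi_zero; assumption.
- apply (metric_evolution g Sg Ng x y phi (fun p t => lam + intphi x y p t)); assumption.
- apply (curvature_evolution g Sg Ng x y phi (fun p t => lam + intphi x y p t)); assumption.
Qed.
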